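(* Let $\mathcal{C}$ be an additive category which has cokernels and pseudo-kernels. Then the following conditions are equivalent: (i) the functor $v:\mathrm{mod}(\mathcal{C})\to\mathcal{C}$ preserves pseudo-kernels; (ii) the functor $v:\mathrm{mod}(\mathcal{C})\to\mathcal{C}$ is left exact; (iii) $\mathcal{C}$ is abelian.
   Context: $\mathcal{C}$ is a small category (relative to a fixed universe). $\mathrm{Mod}(\mathcal{C})$ is the category of additive functors $\mathcal{C}^{\mathrm{op}}\to\mathrm{Ab}$. A functor $F\in\mathrm{Mod}(\mathcal{C})$ is coherent if there is an exact sequence $\mathrm{Hom}_{\mathcal{C}}(-,A)\to\mathrm{Hom}_{\mathcal{C}}(-,B)\to F\to 0$ (a presentation of $F$) with $A,B\in\mathcal{C}$; $\mathrm{mod}(\mathcal{C})$ is the full subcategory of coherent functors. When $\mathcal{C}$ has cokernels, the Yoneda functor $h_{\mathcal{C}}:\mathcal{C}\to\mathrm{mod}(\mathcal{C})$, $A\mapsto\mathrm{Hom}_{\mathcal{C}}(-,A)$, has a left adjoint $v:\mathrm{mod}(\mathcal{C})\to\mathcal{C}$, given by $v(F)=\mathrm{Coker}(X\to Y)$ for a presentation $\mathrm{Hom}_{\mathcal{C}}(-,X)\to\mathrm{Hom}_{\mathcal{C}}(-,Y)\to F\to 0$. A morphism $B\to A$ in an additive category $\mathcal{A}$ is a pseudo-kernel of a morphism $A\to C$ if the induced sequence $\mathrm{Hom}_{\mathcal{A}}(-,B)\to\mathrm{Hom}_{\mathcal{A}}(-,A)\to\mathrm{Hom}_{\mathcal{A}}(-,C)$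 is exact; $\mathcal{A}$ has pseudo-kernels if every morphism has one. It is known (Freyd) that $\mathcal{C}$ has pseudo-kernels if and only if $\mathrm{mod}(\mathcal{C})$ is abelian. A functor preserves pseudo-kernels if it sends every pseudo-kernel of a morphism to a pseudo-kernel of the image of that morphism. Left exact means preserving kernels. *)

(* Defs.v *)
From HB Require Import structures.
From mathcomp Require Import all_boot all_algebra boolp.

Set Implicit Arguments.
Unset Strict Implicit.
Unset Printing Implicit Defensive.

Import GRing.Theory.
Local Open Scope ring_scope.

Declare Scope cat_scope.
Delimit Scope cat_scope with cat.
Reserved Notation "g ∘ f" (at level 40, left associativity).

(* Abelian groups are [zmodType]s; with the classical axioms of [boolp], every
   abelian group carries the choice structure that [zmodType] asks for. *)

(* The type of objects is a parameter, not a field, so that the same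
   definitions apply to small categories and to the (large) categories of
   functors on them. *)
Record preadditive (ob : Type) := Preadditive {
  hom : ob -> ob -> zmodType;
  idm : forall X, hom X X;
  comp : forall X Y Z, hom Y Z -> hom X Y -> hom X Z;
  comp1m : forall X Y (f : hom X Y), comp (idm Y) f = f;
  compm1 : forall X Y (f : hom X Y), comp f (idm X) = f;
  compmA : forall X Y Z W (h : hom Z W) (g : hom Y Z) (f : hom X Y),
    comp h (comp g f) = comp (comp h g) f;
  compmB : forall X Y Z (g : hom Y Z), zmod_morphism (@comp X Y Z g);
  compBm : forall X Y Z (f : hom X Y), zmod_morphism ((@comp X Y Z)^~ f)
}.

Arguments hom {ob} p X Y.
Arguments idm {ob} p X.
Arguments comp {ob} p {X Y Z} g f.
Notation "g ∘ f" := (comp _ g f) : cat_scope.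
Local Open Scope cat_scope.

HB.instance Definition _ (ob : Type) (C : preadditive ob) (X Y Z : ob)
    (g : hom C Y Z) :=
  GRing.isZmodMorphism.Build _ _ (comp C g : hom C X Y -> hom C X Z)
    (@compmB _ C X Y Z g).

Definition exact_at (U V W : zmodType) (f : U -> V) (g : V -> W) : Prop :=
  forall y : V, g y = 0 <-> exists x : U, f x = y.

Section CategoricalNotions.
Variables (ob : Type) (C : preadditive ob).

Definition is_zero_object (Z : ob) : Prop :=
  (forall X, exists! f : hom C Z X, True) /\
  (forall X, exists! f : hom C X Z, True).

Definition is_biproduct (A B P : ob) (iA : hom C A P) (iB : hom C B P)
    (pA : hom C P A) (pB : hom C P B) : Prop :=
  [/\ pA ∘ iA = idm C A, pB ∘ iB = idm C B, pA ∘ iB = 0, pB ∘ iA = 0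
    & iA ∘ pA + iB ∘ pB = idm C P].

Definition is_additive : Prop :=
  (exists Z, is_zero_object Z) /\
  (forall A B, exists P iA iB pA pB, @is_biproduct A B P iA iB pA pB).

Definition is_kernel (X Y Z : ob) (k : hom C X Y) (f : hom C Y Z) : Prop :=
  f ∘ k = 0 /\
  forall T (t : hom C T Y), f ∘ t = 0 -> exists! u : hom C T X, k ∘ u = t.

Definition is_cokernel (X Y Z : ob) (f : hom C X Y) (c : hom C Y Z) : Prop :=
  c ∘ f = 0 /\
  forall T (t : hom C Y T), t ∘ f = 0 -> exists! u : hom C Z T, u ∘ c = t.

Definition has_kernels : Prop :=
  forall Y Z (f : hom C Y Z), exists X (k : hom C X Y), is_kernel k f.

Definition has_cokernels : Prop :=
  forall X Y (f : hom C X Y), exists Z (c : hom C Y Z), is_cokernel f c.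

Definition is_mono (X Y : ob) (f : hom C X Y) : Prop :=
  forall T (a b : hom C T X), f ∘ a = f ∘ b -> a = b.

Definition is_epi (X Y : ob) (f : hom C X Y) : Prop :=
  forall T (a b : hom C Y T), a ∘ f = b ∘ f -> a = b.

Definition is_abelian : Prop :=
  [/\ is_additive, has_kernels, has_cokernels,
      forall X Y (m : hom C X Y), is_mono m ->
        exists Z (f : hom C Y Z), is_kernel m f
    & forall Y Z (e : hom C Y Z), is_epi e ->
        exists X (f : hom C X Y), is_cokernel f e].

(* b : B -> A is a pseudo-kernel of a : A -> D when
   Hom(-, B) -> Hom(-, A) -> Hom(-, D) is exact. *)
Definition is_pseudo_kernel (B A D : ob) (b : hom C B A) (a : hom C A D) :
    Prop :=
  forall X : ob,
    exact_at (comp C b : hom C X B -> hom C X A)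
             (comp C a : hom C X A -> hom C X D).

Definition has_pseudo_kernels : Prop :=
  forall A D (a : hom C A D), exists B (b : hom C B A), is_pseudo_kernel b a.

Lemma comp0m X Y Z (f : hom C X Y) : (0 : hom C Y Z) ∘ f = 0.
Proof. by rewrite -[0 in LHS](subrr 0) (compBm f) subrr. Qed.

Lemma compm0 X Y Z (g : hom C Y Z) : g ∘ (0 : hom C X Y) = 0.
Proof. exact: raddf0. Qed.

End CategoricalNotions.

Record functor (ob ob' : Type) (C : preadditive ob) (D : preadditive ob') :=
  Functor {
    fob :> ob -> ob';
    fmap : forall X Y, hom C X Y -> hom D (fob X) (fob Y);
    fmap1 : forall X, fmap (idm C X) = idm D (fob X);
    fmapM : forall X Y Z (g : hom C Y Z) (f : hom C X Y),
      fmap (g ∘ f) = fmap g ∘ fmap f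
  }.
Arguments fmap {ob ob' C D} _ {X Y} _.

Section FunctorNotions.
Variables (ob ob' : Type) (C : preadditive ob) (D : preadditive ob').

Definition is_left_exact (L : functor C D) : Prop :=
  forall X Y Z (k : hom C X Y) (f : hom C Y Z),
    is_kernel k f -> is_kernel (fmap L k) (fmap L f).

Definition preserves_pseudo_kernels (L : functor C D) : Prop :=
  forall X Y Z (b : hom C X Y) (a : hom C Y Z),
    is_pseudo_kernel b a -> is_pseudo_kernel (fmap L b) (fmap L a).

Definition is_left_adjoint (L : functor C D) (R : functor D C) : Prop :=
  exists eta : forall X, hom C X (R (L X)),
    (forall X Y (f : hom C X Y), fmap R (fmap L f) ∘ eta X = eta Y ∘ f) /\
    (forall X Y (f : hom C X (R Y)),
       exists! u : hom D (L X) Y, fmap R u ∘ eta X = f).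

End FunctorNotions.

Section FullSubcategory.
Variables (ob : Type) (C : preadditive ob) (P : ob -> Prop).

Definition full_subcategory : preadditive {X : ob | P X} :=
  @Preadditive {X : ob | P X} (fun X Y => hom C (sval X) (sval Y))
    (fun X => idm C (sval X))
    (fun X Y Z => @comp _ C (sval X) (sval Y) (sval Z))
    (fun X Y => @comp1m _ C (sval X) (sval Y))
    (fun X Y => @compm1 _ C (sval X) (sval Y))
    (fun X Y Z W => @compmA _ C (sval X) (sval Y) (sval Z) (sval W))
    (fun X Y Z => @compmB _ C (sval X) (sval Y) (sval Z))
    (fun X Y Z => @compBm _ C (sval X) (sval Y) (sval Z)).

End FullSubcategory.

(* Additive functors C^op -> Ab, unfolded: [mres] is the action on morphisms. *)
Record cmodule (ob : Type) (C : preadditive ob) := CModule {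
  mob :> ob -> zmodType;
  mres : forall X Y, hom C X Y -> mob Y -> mob X;
  mres1 : forall X (x : mob X), mres (idm C X) x = x;
  mresM : forall X Y Z (g : hom C Y Z) (f : hom C X Y) (z : mob Z),
    mres (g ∘ f) z = mres f (mres g z);
  mres_additive : forall X Y (f : hom C X Y), zmod_morphism (mres f);
  mresBl : forall X Y (y : mob Y),
    zmod_morphism ((fun f => mres f y) : hom C X Y -> mob X)
}.
Arguments mres {ob C} _ {X Y} _ _.

HB.instance Definition _ (ob : Type) (C : preadditive ob) (F : cmodule C)
    (X Y : ob) (f : hom C X Y) :=
  GRing.isZmodMorphism.Build _ _ (@mres _ C F X Y f) (mres_additive f).

Record nattrans (ob : Type) (C : preadditive ob) (F G : cmodule C) :=
  NatTrans {
    nt :> forall X, F X -> G X;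
    nt_additive : forall X, zmod_morphism (@nt X);
    nt_natural : forall X Y (f : hom C X Y) (y : F Y),
      nt (mres F f y) = mres G f (nt y)
  }.
Arguments nt {ob C F G} _ {X} _.

HB.instance Definition _ (ob : Type) (C : preadditive ob) (F G : cmodule C)
    (a : nattrans F G) (X : ob) :=
  GRing.isZmodMorphism.Build _ _ (@nt _ C F G a X) (@nt_additive _ C F G a X).

Local Obligation Tactic := idtac.

Section ModuleCategory.
Variables (ob : Type) (C : preadditive ob).

Lemma nattransP (F G : cmodule C) (a b : nattrans F G) :
  (forall X (x : F X), nt a x = nt b x) -> a = b.
Proof.
case: a b => [a a1 a2] [b b1 b2] /= ab.
have e : a = b by apply: functional_extensionality_dep => X; apply: funext => x.
rewrite -{}e in b1 b2 *.
by rewrite (Prop_irrelevance a1 b1) (Prop_irrelevance a2 b2).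
Qed.

Section Group.
Variables F G : cmodule C.

HB.instance Definition _ := gen_eqMixin (nattrans F G).
HB.instance Definition _ := gen_choiceMixin (nattrans F G).

Program Definition nt_zero : nattrans F G :=
  @NatTrans _ _ _ _ (fun X _ => 0) _ _.
Next Obligation. by move=> X x y; rewrite subr0. Qed.
Next Obligation. by move=> X Y f y; rewrite raddf0. Qed.

Program Definition nt_opp (a : nattrans F G) : nattrans F G :=
  @NatTrans _ _ _ _ (fun X x => - nt a x) _ _.
Next Obligation. by move=> a X x y /=; rewrite raddfB opprB opprK addrC. Qed.
Next Obligation. by move=> a X Y f y /=; rewrite nt_natural raddfN. Qed.

Program Definition nt_add (a b : nattrans F G) : nattrans F G :=
  @NatTrans _ _ _ _ (fun X x => nt a x + nt b x) _ _.
Next Obligation. by move=> a b X x y /=; rewrite !raddfB opprD addrACA. Qed.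
Next Obligation. by move=> a b X Y f y /=; rewrite !nt_natural raddfD. Qed.

Fact nt_addA : associative nt_add.
Proof. by move=> a b c; apply: nattransP => X x /=; rewrite addrA. Qed.
Fact nt_addC : commutative nt_add.
Proof. by move=> a b; apply: nattransP => X x /=; rewrite addrC. Qed.
Fact nt_add0 : left_id nt_zero nt_add.
Proof. by move=> a; apply: nattransP => X x /=; rewrite add0r. Qed.
Fact nt_addN : left_inverse nt_zero nt_opp nt_add.
Proof. by move=> a; apply: nattransP => X x /=; rewrite addNr. Qed.

HB.instance Definition _ := GRing.isZmodule.Build (nattrans F G)
  nt_addA nt_addC nt_add0 nt_addN.

End Group.

Program Definition nt_id (F : cmodule C) : nattrans F F :=
  @NatTrans _ _ _ _ (fun X x => x) _ _.
Next Obligation. by []. Qed.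
Next Obligation. by []. Qed.

Program Definition nt_comp (F G H : cmodule C) (b : nattrans G H)
    (a : nattrans F G) : nattrans F H :=
  @NatTrans _ _ _ _ (fun X x => nt b (nt a x)) _ _.
Next Obligation. by move=> F G H b a X x y /=; rewrite !raddfB. Qed.
Next Obligation. by move=> F G H b a X Y f y /=; rewrite !nt_natural. Qed.

Program Definition Mod : preadditive (cmodule C) :=
  @Preadditive (cmodule C) (fun F G => nattrans F G : zmodType) nt_id nt_comp
    _ _ _ _ _.
Next Obligation. by move=> F G f; apply: nattransP. Qed.
Next Obligation. by move=> F G f; apply: nattransP. Qed.
Next Obligation. by move=> *; apply: nattransP. Qed.
Next Obligation.
by move=> F G H b a a'; apply: nattransP => X x /=; rewrite raddfB.
Qed.
Next Obligation. by move=> F G H a b b'; apply: nattransP. Qed.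

Program Definition representable (A : ob) : cmodule C :=
  @CModule _ C (fun X => hom C X A) (fun X Y f y => y ∘ f) _ _ _ _.
Next Obligation. by move=> A X x /=; rewrite compm1. Qed.
Next Obligation. by move=> A X Y Z g f z /=; rewrite compmA. Qed.
Next Obligation. by move=> A X Y f; apply: compBm. Qed.
Next Obligation. by move=> A X Y y; apply: compmB. Qed.

Program Definition representable_map (A B : ob) (f : hom C A B) :
    nattrans (representable A) (representable B) :=
  @NatTrans _ _ _ _ (fun X x => f ∘ x) _ _.
Next Obligation. by move=> A B f X; apply: compmB. Qed.
Next Obligation. by move=> A B f X Y g y /=; rewrite compmA. Qed.

(* Objectwise exactness of Hom(-, A) -> Hom(-, B) -> F -> 0, where by the
   Yoneda lemma the first map is composition with some f : A -> B. *)
Definition is_presentation (F : cmodule C) (A B : ob) (f : hom C A B)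
    (p : nattrans (representable B) F) : Prop :=
  forall X : ob,
    exact_at (@nt _ _ _ _ (representable_map f) X) (@nt _ _ _ _ p X) /\
    (forall x : F X, exists y : hom C X B, nt p y = x).

Definition coherent (F : cmodule C) : Prop :=
  exists A B (f : hom C A B) (p : nattrans (representable B) F),
    is_presentation f p.

Definition mod : preadditive {F : cmodule C | coherent F} :=
  full_subcategory Mod coherent.

Lemma representable_coherent (A : ob) : coherent (representable A).
Proof.
exists A, A, 0, (nt_id (representable A)) => X; split=> [y|x]; last by exists x.
split=> /= [->|[x <-]]; last by rewrite comp0m.
by exists 0; rewrite comp0m.
Qed.

Program Definition yoneda : functor C mod :=
  @Functor _ _ C mod
    (fun A => exist _ (representable A) (representable_coherent A))
    representable_map _ _.
Next Obligation. by move=> X; apply: nattransP => Y y /=; rewrite comp1m. Qed.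
Next Obligation.
by move=> X Y Z g f; apply: nattransP => T t /=; rewrite compmA.
Qed.

(* A morphism t : B -> T killing f amounts to a morphism F -> Hom(-, T). *)
Lemma presentation_desc (F : cmodule C) (A B : ob) (f : hom C A B)
    (p : nattrans (representable B) F) (T : ob) (t : hom C B T) :
  is_presentation f p -> t ∘ f = 0 ->
  exists e : nattrans F (representable T),
    forall X (y : hom C X B), nt e (nt p y) = t ∘ y.
Proof.
move=> pP tf0.
have sP X (x : F X) : {y : hom C X B | nt p y = x} by apply: cid; case: (pP X).
have wd X (y : hom C X B) x : nt p y = x -> t ∘ y = t ∘ sval (sP X x).
  case: sP => y' /= <- pyy'; apply/eqP; rewrite -subr_eq0 -raddfB; apply/eqP.
  have : nt p (y - y' : representable B X) = 0 by rewrite raddfB /= pyy' subrr.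
  by case/(pP X).1 => z /= <-; rewrite compmA tf0 comp0m.
unshelve eexists (@NatTrans _ _ F (representable T)
  (fun X x => t ∘ sval (sP X x)) _ _).
- move=> X x x' /=; rewrite -raddfB; apply/esym/wd.
  by rewrite raddfB /= (svalP (sP X x)) (svalP (sP X x')).
- move=> X Y g y /=; rewrite -compmA; apply/esym/wd.
  by rewrite -[in RHS](svalP (sP Y y)) -nt_natural.
- by move=> X y /=; rewrite -(wd X y).
Qed.

End ModuleCategory.

Section CokernelFunctor.
Variables (ob : Type) (C : preadditive ob) (cokC : has_cokernels C).

Definition coker (X Y : ob) (f : hom C X Y) : {Z : ob & hom C Y Z} :=
  let: exist Z cP := cid (cokC f) in
  existT (fun Z => hom C Y Z) Z (sval (cid cP)).

Lemma cokerP (X Y : ob) (f : hom C X Y) : is_cokernel f (projT2 (coker f)).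
Proof. by rewrite /coker; case: cid => Z cP /=; case: cid. Qed.

Record presentation (F : cmodule C) := Presentation {
  pres_dom : ob;
  pres_cod : ob;
  pres_map : hom C pres_dom pres_cod;
  pres_proj : nattrans (representable C pres_cod) F;
  presP : is_presentation pres_map pres_proj
}.

Lemma presentation_exists (F : {F : cmodule C | coherent F}) :
  exists _ : presentation (sval F), True.
Proof.
by case: F => F [A [B [f [p pP]]]]; exists (@Presentation F A B f p pP).
Qed.

Definition pres (F : {F : cmodule C | coherent F}) : presentation (sval F) :=
  sval (cid (presentation_exists F)).

Definition v_ob (F : {F : cmodule C | coherent F}) : ob :=
  projT1 (coker (pres_map (pres F))).

Definition v_proj (F : {F : cmodule C | coherent F}) :
    hom C (pres_cod (pres F)) (v_ob F) :=
  projT2 (coker (pres_map (pres F))).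

Lemma v_unit_exists (F : {F : cmodule C | coherent F}) :
  exists e : hom (mod C) F (yoneda C (v_ob F)),
    forall X (y : hom C X (pres_cod (pres F))),
      nt e (nt (pres_proj (pres F)) y) = v_proj F ∘ y.
Proof.
have [v0 _] := cokerP (pres_map (pres F)).
exact: presentation_desc (presP _) v0.
Qed.

(* The unit F -> Hom(-, v F), induced by Y -> v F = Coker(X -> Y). *)
Definition v_unit (F : {F : cmodule C | coherent F}) :
    hom (mod C) F (yoneda C (v_ob F)) :=
  sval (cid (v_unit_exists F)).

Lemma v_unitE (F : {F : cmodule C | coherent F}) X
    (y : hom C X (pres_cod (pres F))) :
  nt (v_unit F) (nt (pres_proj (pres F)) y) = v_proj F ∘ y.
Proof. by rewrite /v_unit; case: cid. Qed.

Lemma v_universal (F : {F : cmodule C | coherent F}) (T : ob)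
    (a : hom (mod C) F (yoneda C T)) :
  exists! u : hom C (v_ob F) T, fmap (yoneda C) u ∘ v_unit F = a.
Proof.
have [_ vU] := cokerP (pres_map (pres F)).
set p := pres_proj (pres F).
pose B := pres_cod (pres F).
pose t : hom C B T := nt a (nt p (idm C B : representable C B B)).
have pE X (y : hom C X B) :
    nt p (y : representable C B X) =
    mres (sval F) y (nt p (idm C B : representable C B B)).
  by rewrite -nt_natural /= comp1m.
have tE X (y : hom C X B) : nt a (nt p (y : representable C B X)) = t ∘ y.
  by rewrite pE nt_natural.
have t0 : t ∘ pres_map (pres F) = 0.
  rewrite -tE (_ : nt p _ = 0) ?raddf0 //.
  by apply/(presP (pres F) _).1; exists (idm _ _); rewrite /= compm1.
have [u [ut uU]] := vU _ _ t0.
exists u; split=> [|u' u'a].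
  apply: nattransP => X x /=.
  have [y <-] := (presP (pres F) X).2 x.
  by rewrite v_unitE tE compmA; congr (_ ∘ _).
apply: uU; rewrite /t -u'a /=.
by rewrite [X in _ = comp _ _ X]v_unitE compm1.
Qed.

Definition v_map (F G : {F : cmodule C | coherent F}) (a : hom (mod C) F G) :
    hom C (v_ob F) (v_ob G) :=
  sval (cid (v_universal (v_unit G ∘ a))).

Lemma v_mapE (F G : {F : cmodule C | coherent F}) (a : hom (mod C) F G) :
  fmap (yoneda C) (v_map a) ∘ v_unit F = v_unit G ∘ a.
Proof. by rewrite /v_map; case: cid => u [/= ->]. Qed.

Lemma v_eq (F : {F : cmodule C | coherent F}) (T : ob)
    (u w : hom C (v_ob F) T) :
  fmap (yoneda C) u ∘ v_unit F = fmap (yoneda C) w ∘ v_unit F -> u = w.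
Proof.
have [z [_ zU]] := v_universal (fmap (yoneda C) w ∘ v_unit F).
by move=> uw; rewrite -(zU u uw) -(zU w erefl).
Qed.

Lemma v_map1 (F : {F : cmodule C | coherent F}) :
  v_map (idm (mod C) F) = idm C (v_ob F).
Proof. by apply: v_eq; rewrite v_mapE fmap1 comp1m compm1. Qed.

Lemma v_mapM (F G H : {F : cmodule C | coherent F}) (b : hom (mod C) G H)
    (a : hom (mod C) F G) :
  v_map (b ∘ a) = v_map b ∘ v_map a.
Proof.
apply: v_eq.
rewrite v_mapE fmapM; apply/esym.
transitivity (fmap (yoneda C) (v_map b) ∘ (v_unit G ∘ a)).
  by rewrite -v_mapE compmA.
by rewrite !compmA v_mapE.
Qed.

(* On morphisms, v a is the unique morphism compatible with the units. *)
Definition v : functor (mod C) C := Functor v_map1 v_mapM.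

Lemma v_left_adjoint : is_left_adjoint v (yoneda C).
Proof.
by exists v_unit; split=> [F G a|F T a]; [exact: v_mapE | exact: v_universal].
Qed.

(* v F is the cokernel of X -> Y for every presentation of F, not only for the
   chosen one. *)
Lemma v_presentation (F : {F : cmodule C | coherent F}) (X Y : ob)
    (f : hom C X Y) (p : nattrans (representable C Y) (sval F)) :
  is_presentation f p ->
  is_cokernel f (nt (v_unit F) (nt p (idm C Y : representable C Y Y)) :
                   hom C Y (v F)).
Proof.
move=> pP.
have pE Z (y : hom C Z Y) : nt p (y : representable C Y Z) =
    mres (sval F) y (nt p (idm C Y : representable C Y Y)).
  by rewrite -nt_natural /= comp1m.
split=> [|T t tf0].
  rewrite -[LHS]/(mres (representable C _) f _) -nt_natural -pE.
  rewrite (_ : nt p _ = 0) ?raddf0 //.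
  by apply/(pP X).1; exists (idm _ _); rewrite /= compm1.
have [e eE] := presentation_desc pP tf0.
have [u [ue uU]] := v_universal (F := F) (e : hom (mod C) F (yoneda C T)).
exists u; split=> [|u' u't].
  by rewrite -[LHS]/(nt (fmap (yoneda C) u ∘ v_unit F) _) ue eE compm1.
apply: uU; apply: nattransP => Z z.
have [y <-] := (pP Z).2 z.
by rewrite eE -u't /= pE nt_natural /= compmA.
Qed.

End CokernelFunctor.

(* Main.v *)
From HB Require Import structures.
From mathcomp Require Import all_boot all_algebra boolp.
Require Import Defs.

(** The equivalence of the first two conditions is formal once [mod C] is known
    to have kernels ([mod_has_kernels]): a kernel is the same thing as a
    pseudo-kernel that is a monomorphism, being a monomorphism is itself a
    pseudo-kernel condition (with zero as pseudo-kernel), and conversely a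
    pseudo-kernel is a kernel preceded by a split epimorphism.

    Assume that [C] is abelian. The unit [F -> Hom(-, v F)] is then locally
    bijective for the topology of epimorphisms: every [t : T -> v F] comes,
    after composition with an epimorphism to [T], from an element of [F], and
    every element of [F T] that dies in [Hom(T, v F)] dies after restriction
    along an epimorphism to [T]. In other words [v] is sheafification, and it
    is left exact for the same reason: kernels of modules are computed
    objectwise ([kernel_objectwise]), a kernel relation in [C] holds as soon as
    it holds epi-locally, and a morphism that factors epi-locally through a
    monomorphism factors through it, because that monomorphism is a kernel.
    The facts needed from abelian categories are that epimorphisms pull back to
    epimorphisms ([epi_pullback]) and that exactness at [Y] of
    [X -> Y -> Coker] can be tested epi-locally ([exact_epi_lift]).

    Assume that [v] is left exact. As [v (Hom(-, X))] is [X], applying [v]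
    transports to [C] any kernel in [mod C] of a map out of a representable
    functor. The kernel of [Hom(-, f)] gives a kernel of [f]. A monomorphism
    [m : X -> Y] makes [Hom(-, m)] a kernel of the projection onto its coherent
    cokernel, so [m] is a kernel. If [e] is an epimorphism with kernel [k], the
    cokernel [F] of [Hom(-, k)] embeds in the functor represented by the target
    of [e]; hence [v F = Coker k] maps to this target by a monomorphism, which
    is also an epimorphism and thus invertible since monomorphisms are kernels,
    and [e] is the cokernel of [k]. *)

Set Implicit Arguments.
Unset Strict Implicit.
Unset Printing Implicit Defensive.

Import GRing.Theory.
Import Quotient.
Local Open Scope ring_scope.
Local Open Scope quotient_scope.
Local Open Scope cat_scope.
Local Obligation Tactic := idtac.

(** * Kernels, pseudo-kernels and weak pullbacks *)

Section Preadditive.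
Variables (ob : Type) (C : preadditive ob).

Lemma compBr X Y Z (g : hom C Y Z) (a b : hom C X Y) :
  g ∘ (a - b) = g ∘ a - g ∘ b.
Proof. exact: compmB. Qed.

Lemma compBl X Y Z (f : hom C X Y) (a b : hom C Y Z) :
  (a - b) ∘ f = a ∘ f - b ∘ f.
Proof. exact: (compBm f). Qed.

Lemma compDr X Y Z (g : hom C Y Z) (a b : hom C X Y) :
  g ∘ (a + b) = g ∘ a + g ∘ b.
Proof. exact: raddfD. Qed.

Lemma monoP X Y (f : hom C X Y) :
  (forall T (a : hom C T X), f ∘ a = 0 -> a = 0) -> is_mono f.
Proof. by move=> f0 T a b /eqP; rewrite -subr_eq0 -compBr => /eqP/f0/subr0_eq. Qed.

Lemma mono0 X Y (f : hom C X Y) T (a : hom C T X) :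
  is_mono f -> f ∘ a = 0 -> a = 0.
Proof. by move=> fM fa; apply: fM; rewrite compm0. Qed.

Lemma epiP X Y (f : hom C X Y) :
  (forall T (a : hom C Y T), a ∘ f = 0 -> a = 0) -> is_epi f.
Proof. by move=> f0 T a b /eqP; rewrite -subr_eq0 -compBl => /eqP/f0/subr0_eq. Qed.

Lemma epi0 X Y (f : hom C X Y) T (a : hom C Y T) :
  is_epi f -> a ∘ f = 0 -> a = 0.
Proof. by move=> fE fa; apply: fE; rewrite comp0m. Qed.

Lemma epi_comp X Y Z (g : hom C Y Z) (f : hom C X Y) :
  is_epi g -> is_epi f -> is_epi (g ∘ f).
Proof. by move=> gE fE T a b; rewrite !compmA => /fE/gE. Qed.

Lemma kernel_mono X Y Z (k : hom C X Y) (f : hom C Y Z) :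
  is_kernel k f -> is_mono k.
Proof.
move=> [fk kU]; apply: monoP => T a ka.
have [|u [_ uU]] := kU T 0; first by rewrite compm0.
by rewrite -(uU a ka) -(uU 0) ?compm0.
Qed.

Lemma cokernel_epi X Y Z (f : hom C X Y) (c : hom C Y Z) :
  is_cokernel f c -> is_epi c.
Proof.
move=> [cf cU]; apply: epiP => T a ac.
have [|u [_ uU]] := cU T 0; first by rewrite comp0m.
by rewrite -(uU a ac) -(uU 0) ?comp0m.
Qed.

Lemma pseudo_kernelP B A D (b : hom C B A) (a : hom C A D) :
  is_pseudo_kernel b a <->
  a ∘ b = 0 /\ forall T (t : hom C T A), a ∘ t = 0 -> exists u, b ∘ u = t.
Proof.
split=> [ba|[ab bU] T t].
  split=> [|T t /(ba T)//].
  by apply/(ba B); exists (idm C B); rewrite /= compm1.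
by split=> [/bU|[u <-]] //=; rewrite compmA ab comp0m.
Qed.

Lemma kernelP X Y Z (k : hom C X Y) (f : hom C Y Z) :
  is_kernel k f <-> is_pseudo_kernel k f /\ is_mono k.
Proof.
split=> [kP|[/pseudo_kernelP[fk kU] kM]].
  split; last exact: kernel_mono kP.
  apply/pseudo_kernelP; split=> [|T t]; first by case: kP.
  by case: kP => _ kU /kU[u [ut _]]; exists u.
split=> // T t /kU[u ut]; exists u; split=> // u' u't.
by apply: kM; rewrite ut.
Qed.

(** This turns monomorphisms into an instance of the relation preserved by a
    functor that preserves pseudo-kernels. *)
Lemma mono_zero_pseudo_kernel X Y (k : hom C X Y) :
  is_mono k <-> is_pseudo_kernel (0 : hom C X X) k.
Proof.
split=> [kM|/pseudo_kernelP[_ kU]].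
  apply/pseudo_kernelP; split=> [|T t /(mono0 kM) ->]; first exact: compm0.
  by exists 0; rewrite compm0.
by apply: monoP => T a /kU[u <-]; rewrite comp0m.
Qed.

(** An isomorphism of arrows carries kernels to kernels; on the target side a
    monomorphism is enough. *)
Lemma kernel_transport X Y Z X' Y' Z' (k' : hom C X' Y') (f' : hom C Y' Z')
    (k : hom C X Y) (f : hom C Y Z) (i : hom C X X') (i' : hom C X' X)
    (j : hom C Y Y') (l : hom C Z Z') :
  i ∘ i' = idm C X' -> is_mono i -> is_mono j -> is_mono l ->
  k' ∘ i = j ∘ k -> f' ∘ j = l ∘ f -> is_kernel k' f' -> is_kernel k f.
Proof.
move=> ii' iM jM lM sq1 sq2 k'P; have k'M := kernel_mono k'P.
case: k'P => f'k' k'U.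
have fk : f ∘ k = 0.
  by apply: (mono0 lM); rewrite compmA -sq2 -compmA -sq1 compmA f'k' comp0m.
have kM : is_mono k.
  apply: monoP => T a ka; apply: (mono0 iM); apply: (mono0 k'M).
  by rewrite compmA sq1 -compmA ka compm0.
apply/kernelP; split=> //; apply/pseudo_kernelP; split=> // T t ft.
have [|u [ut _]] := k'U _ (j ∘ t).
  by rewrite compmA sq2 -compmA ft compm0.
exists (i' ∘ u); apply: jM.
by rewrite compmA -sq1 -compmA (compmA i) ii' comp1m.
Qed.

(** [r] and [s] complete [f] and [g] to a weak pullback: a commutative square
    through which every other one factors, not necessarily uniquely. *)
Definition is_weak_pullback A B D P (f : hom C A D) (g : hom C B D)
    (r : hom C P A) (s : hom C P B) : Prop :=
  f ∘ r = g ∘ s /\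
  forall T (t : hom C T A) (u : hom C T B), f ∘ t = g ∘ u ->
    exists w : hom C T P, r ∘ w = t /\ s ∘ w = u.

(** A weak pullback of [f] and [g] is a pseudo-kernel of [f - g] on the
    biproduct of their sources. *)
Lemma weak_pullback_exists A B D (f : hom C A D) (g : hom C B D) :
  is_additive C -> has_pseudo_kernels C ->
  exists P (r : hom C P A) (s : hom C P B), is_weak_pullback f g r s.
Proof.
move=> [_ biC] pkC; have [S [iA [iB [pA [pB [AA BB AB BA SS]]]]]] := biC A B.
have [P [k /pseudo_kernelP[k0 kU]]] := pkC _ _ (f ∘ pA - g ∘ pB).
exists P, (pA ∘ k), (pB ∘ k); split=> [|T t u ftu].
  by apply/eqP; rewrite -subr_eq0 !compmA -compBl k0.
have [|w wE] := kU _ (iA ∘ t + iB ∘ u).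
  rewrite compDr !compBl -!compmA !(compmA pA) !(compmA pB) AA BB AB BA.
  by rewrite !comp1m !comp0m !compm0 subr0 sub0r ftu subrr.
exists w; rewrite -!compmA wE !compDr !compmA AA AB BA BB.
by rewrite !comp1m !comp0m addr0 add0r.
Qed.

End Preadditive.

(** * Epimorphisms in an abelian category *)

Section Abelian.
Variables (ob : Type) (C : preadditive ob).
Hypothesis abC : is_abelian C.

Lemma abelian_pseudo_kernels : has_pseudo_kernels C.
Proof.
by case: abC => _ kC _ _ _ A D a; have [B [b /kernelP[]]] := kC _ _ a; exists B, b.
Qed.

(** The difference map [d] on the biproduct is an epimorphism because [f] is,
    hence is the cokernel of some [h], and [h] factors through the weak
    pullback. If [a] kills [s], then [a ∘ pB] kills [h] and descends along [d];
    on the summand [A] the descended map shows that it is zero. *)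
Lemma weak_pullback_epi A B D P (f : hom C A D) (g : hom C B D)
    (r : hom C P A) (s : hom C P B) :
  is_weak_pullback f g r s -> is_epi f -> is_epi s.
Proof.
case: abC => -[_ biC] _ _ _ epiC [frs wU] fE.
have [S [iA [iB [pA [pB [AA BB AB BA SS]]]]]] := biC A B.
set d := f ∘ pA - g ∘ pB.
have diA : d ∘ iA = f by rewrite compBl -!compmA AA BA compm1 compm0 subr0.
have dE : is_epi d.
  by apply: epiP => T a ad; apply: (epi0 fE); rewrite -diA compmA ad comp0m.
have [Q [h hP]] := epiC _ _ _ dE; have [dh dU] := hP.
have [|w [wr ws]] := wU _ (pA ∘ h) (pB ∘ h).
  by apply/eqP; rewrite -subr_eq0 !compmA -compBl dh.
apply: epiP => T a as0.
have [|u [ud _]] := dU _ (a ∘ pB); first by rewrite -compmA -ws compmA as0 comp0m.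
have u0 : u = 0.
  by apply: (epi0 fE); rewrite -diA compmA ud -compmA BA compm0.
by rewrite -[a]compm1 -BB compmA -ud u0 !comp0m.
Qed.

Lemma epi_pullback A B D (f : hom C A D) (g : hom C B D) :
  is_epi f ->
  exists P (r : hom C P A) (s : hom C P B), is_epi s /\ f ∘ r = g ∘ s.
Proof.
move=> fE; have [addC _ _ _ _] := abC.
have [P [r [s wP]]] := weak_pullback_exists f g addC abelian_pseudo_kernels.
exists P, r, s; split; first exact: weak_pullback_epi wP fE.
by case: wP.
Qed.

(** An element killed by the cokernel of [f] lies in the image of [f] up to
    restriction along an epimorphism: [f] factors as an epimorphism [q] followed
    by the kernel of [c], and [y] lifts along [q] after pulling back. *)
Lemma exact_epi_lift X Y W (f : hom C X Y) (c : hom C Y W) T (y : hom C T Y) :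
  is_cokernel f c -> c ∘ y = 0 ->
  exists T' (e : hom C T' T) (x : hom C T' X), is_epi e /\ f ∘ x = y ∘ e.
Proof.
case: (abC) => _ kC _ monoC _ [cf cU] cy.
have [I [i iP]] := kC _ _ c; have [ci iU] := iP.
have iM := kernel_mono iP.
have [q [qf _]] := iU _ _ cf; have [y' [y'y _]] := iU _ _ cy.
(* If [g] kills [q], then [f] factors through the kernel [i ∘ j] of some [h];
   as [h] descends to the cokernel [c], [i] itself factors through [i ∘ j], so
   the kernel [j] of [g] is split and [g] vanishes. *)
have qE : is_epi q.
  apply: epiP => V g gq.
  have [J [j jP]] := kC _ _ g; have [gj jU] := jP.
  have [q' [q'q _]] := jU _ _ gq.
  have ijM : is_mono (i ∘ j).
    apply: monoP => S a; rewrite -compmA => /(mono0 iM).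
    exact: mono0 (kernel_mono jP).
  have [U [h [hij hU]]] := monoC _ _ _ ijM.
  have [|h' [h'h _]] := cU _ h.
    by rewrite -qf -q'q !compmA -(compmA h) hij comp0m.
  have [|s [si _]] := hU _ i; first by rewrite -h'h -compmA ci compm0.
  have js : j ∘ s = idm C I by apply: iM; rewrite compmA si compm1.
  by rewrite -[g]compm1 -js compmA gj comp0m.
have [T' [x [e [eE xe]]]] := epi_pullback y' qE.
by exists T', e, x; split=> //; rewrite -qf -y'y -!compmA xe.
Qed.

(** A monomorphism [k] is the kernel of some [g], and [g ∘ t = 0] can be tested
    after composition with an epimorphism. *)
Lemma epi_locally_factor X Y Z (k : hom C X Y) (t : hom C Z Y) T
    (e : hom C T Z) (z : hom C T X) :
  is_mono k -> is_epi e -> k ∘ z = t ∘ e -> exists u, k ∘ u = t.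
Proof.
case: abC => _ _ _ monoC _ kM eE kz.
have [V [g [gk gU]]] := monoC _ _ _ kM.
have [|u [ut _]] := gU _ t; last by exists u.
by apply: (epi0 eE); rewrite -compmA -kz compmA gk comp0m.
Qed.

End Abelian.

(** * Submodules and quotient modules *)

Section Submodules.
Variables (ob : Type) (C : preadditive ob) (F : cmodule C).

(** Membership is boolean so that the subgroup and quotient constructions on
    abelian groups apply. *)
Record submodule := Submodule {
  smem : forall X, F X -> bool;
  smem_closed : forall X, zmod_closed (@smem X);
  smem_res : forall X Y (f : hom C X Y) (y : F Y), smem y -> smem (mres F f y)
}.

Variable N : submodule.

HB.instance Definition _ X :=
  GRing.isZmodClosed.Build (F X) (@smem N X) (@smem_closed N X).

Inductive sub_at X := SubAt x of @smem N X x.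
Definition sub_val X (u : sub_at X) : F X := let: SubAt x _ := u in x.
HB.instance Definition _ X := [isSub for @sub_val X].
HB.instance Definition _ X := [Choice of sub_at X by <:].
HB.instance Definition _ X := [SubChoice_isSubZmodule of sub_at X by <:].

Lemma sub_valP X (u : sub_at X) : smem N (sub_val u).
Proof. by case: u. Qed.

Lemma sub_val_inj X : injective (@sub_val X).
Proof. exact: val_inj. Qed.

Definition sub_zmod X : zmodType := sub_at X.

Lemma sub_valB X : zmod_morphism (@sub_val X : sub_zmod X -> F X).
Proof. by move=> x y; exact: (raddfB (\val : sub_at X -> F X)). Qed.

Program Definition sub_module : cmodule C :=
  @CModule _ C sub_zmod
    (fun X Y f y => SubAt (smem_res f (sub_valP y))) _ _ _ _.
Next Obligation. by move=> X x; apply: sub_val_inj; rewrite /= mres1. Qed.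
Next Obligation. by move=> X Y Z g f z; apply: sub_val_inj; rewrite /= mresM. Qed.
Next Obligation.
move=> X Y f x y; apply: sub_val_inj.
by rewrite [RHS]sub_valB -[LHS]/(mres F f (sub_val (x - y))) sub_valB raddfB.
Qed.
Next Obligation.
by move=> X Y y f g; apply: sub_val_inj; rewrite sub_valB /= mresBl.
Qed.

Program Definition sub_incl : nattrans sub_module F :=
  @NatTrans _ _ _ _ (fun X x => sub_val x) _ _.
Next Obligation. exact: sub_valB. Qed.
Next Obligation. by []. Qed.

Definition mem_zmodClosed X : zmodClosed (F X) :=
  GRing.ZmodClosed.clone (F X) (@smem N X) _.

Definition quo_at X : zmodType := {quot (mem_zmodClosed X)}.
Definition quo_pi X (x : F X) : quo_at X := \pi_{quot (mem_zmodClosed X)} x.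

Lemma quo_piB X : zmod_morphism (@quo_pi X).
Proof. exact: pi_is_zmod_morphism. Qed.

Lemma quo_pi_surj X (u : quo_at X) : exists x, quo_pi x = u.
Proof. by exists (repr u); exact: reprK. Qed.

Lemma quo_pi_eq X (x y : F X) : quo_pi x = quo_pi y <-> smem N (x - y).
Proof.
rewrite -[smem N _]/(x - y \in mem_zmodClosed X) idealrBE.
by split=> [xy|/eqP]; first by apply/eqP.
Qed.

Lemma quo_res_subproof X Y (f : hom C X Y) :
  exists r : quo_at Y -> quo_at X,
    forall y, r (quo_pi y) = quo_pi (mres F f y).
Proof.
exists (fun u => quo_pi (mres F f (repr u : F Y))) => y.
apply/quo_pi_eq; rewrite -raddfB; apply: smem_res; apply/quo_pi_eq.
exact: reprK.
Qed.

Definition quo_res X Y (f : hom C X Y) : quo_at Y -> quo_at X :=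
  sval (cid (quo_res_subproof f)).

Lemma quo_resE X Y (f : hom C X Y) y :
  quo_res f (quo_pi y) = quo_pi (mres F f y).
Proof. by rewrite /quo_res; case: cid. Qed.

Program Definition quo_module : cmodule C :=
  @CModule _ C quo_at quo_res _ _ _ _.
Next Obligation.
by move=> X u; have [x <-] := quo_pi_surj u; rewrite quo_resE mres1.
Qed.
Next Obligation.
by move=> X Y Z g f u; have [x <-] := quo_pi_surj u; rewrite !quo_resE mresM.
Qed.
Next Obligation.
move=> X Y f u w; have [x <-] := quo_pi_surj u; have [y <-] := quo_pi_surj w.
by rewrite -quo_piB !quo_resE raddfB quo_piB.
Qed.
Next Obligation.
move=> X Y u f g; have [x <-] := quo_pi_surj u.
by rewrite !quo_resE mresBl quo_piB.
Qed.

Program Definition quo_proj : nattrans F quo_module :=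
  @NatTrans _ _ _ _ quo_pi _ _.
Next Obligation. exact: quo_piB. Qed.
Next Obligation. by move=> X Y f y /=; rewrite quo_resE. Qed.

Lemma quo_proj_eq0 X (x : F X) : nt quo_proj x = 0 <-> smem N x.
Proof.
rewrite -[x in smem N x]subr0 -quo_pi_eq /=.
by rewrite -(subrr (0 : F X)) quo_piB subrr.
Qed.

End Submodules.

Section SubmoduleExamples.
Variables (ob : Type) (C : preadditive ob).

Program Definition kernel_submodule (F G : cmodule C) (a : nattrans F G) :
    submodule F :=
  @Submodule _ _ F (fun X x => nt a x == 0) _ _.
Next Obligation.
move=> F G a X; split=> [|x y]; rewrite !unfold_in /=; first by rewrite raddf0.
by move=> /eqP ax /eqP ay; rewrite raddfB /= ax ay subr0.
Qed.
Next Obligation. by move=> F G a X Y f y /eqP ay; rewrite nt_natural ay raddf0. Qed.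

Program Definition image_submodule (F G : cmodule C) (a : nattrans F G) :
    submodule G :=
  @Submodule _ _ G (fun X y => `[< exists x, nt a x = y >]) _ _.
Next Obligation.
move=> F G a X; split=> [|x y]; rewrite !unfold_in /=.
  by apply/asboolP; exists 0; rewrite raddf0.
move=> /asboolP[x' <-] /asboolP[y' <-]; apply/asboolP; exists (x' - y').
by rewrite raddfB.
Qed.
Next Obligation.
move=> F G a X Y f y /asboolP[x <-]; apply/asboolP; exists (mres F f x).
by rewrite nt_natural.
Qed.

End SubmoduleExamples.

(** * Kernels and cokernels of coherent functors *)

Section Coherent.
Variables (ob : Type) (C : preadditive ob).

Lemma exact_atP (U V W : zmodType) (f : U -> V) (g : V -> W) :
  exact_at f g <->
  (forall x, g (f x) = 0) /\ (forall y, g y = 0 -> exists x, f x = y).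
Proof.
split=> [fg|[gf fg] y]; first by split=> [x|y /fg//]; apply/fg; exists x.
by split=> [/fg|[x <-]].
Qed.

(** The quotient of [Hom(-, Y)] by the image of [Hom(-, f)] is presented by [f]. *)
Lemma cokernel_coherent X Y (f : hom C X Y) :
  exists (F : {F : cmodule C | coherent F})
         (p : nattrans (representable C Y) (sval F)), is_presentation f p.
Proof.
pose N := image_submodule (representable_map f).
have pP : is_presentation f (quo_proj N).
  move=> T; split; last exact: quo_pi_surj.
  move=> y; rewrite quo_proj_eq0; split=> [/asboolP//|yE].
  by apply/asboolP.
have cF : coherent (quo_module N) by exists X, Y, f, (quo_proj N).
by exists (exist _ _ cF), (quo_proj N).
Qed.

(** The Yoneda lemma: elements of [F T] are maps from [Hom(-, T)] to [F]. *)
Lemma yoneda_element (F : cmodule C) T (x : F T) :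
  exists y : nattrans (representable C T) F,
    forall S (t : hom C S T), nt y t = mres F t x.
Proof.
unshelve eexists (@NatTrans _ _ (representable C T) F (fun S t => mres F t x) _ _).
- by move=> S; apply: mresBl.
- by move=> S S' f t; rewrite /= mresM.
- by [].
Qed.

Lemma presentationE (F : cmodule C) Y (p : nattrans (representable C Y) F) T
    (y : hom C T Y) :
  nt p (y : representable C Y T) =
    mres F y (nt p (idm C Y : representable C Y Y)).
Proof. by rewrite -nt_natural /= comp1m. Qed.

Section Kernels.
Variables (K F G : {F : cmodule C | coherent F}).
Variables (k : hom (mod C) K F) (a : hom (mod C) F G).

Lemma objectwise_kernel :
  (forall T (z : sval K T), nt k z = 0 -> z = 0) ->
  (forall T, exact_at (@nt _ _ _ _ k T) (@nt _ _ _ _ a T)) ->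
  is_kernel k a.
Proof.
move=> k0 ka.
have kI T (z z' : sval K T) : nt k z = nt k z' -> z = z'.
  by move/eqP; rewrite -subr_eq0 -raddfB => /eqP/k0/subr0_eq.
split=> [|H t at0].
  by apply: nattransP => T z; apply/(ka T); exists z.
have lift T (x : sval H T) : {z | nt k z = nt t x}.
  by apply: cid; apply/(ka T); rewrite -[LHS]/(nt (a ∘ t) x) at0.
have liftE T x : nt k (sval (lift T x)) = nt t x by apply: (svalP (lift T x)).
unshelve eexists (@NatTrans _ _ (sval H) (sval K)
  (fun T x => sval (lift T x)) _ _).
- by move=> T x y; apply: kI; rewrite [RHS]raddfB /= !liftE raddfB.
- by move=> S T f x; apply: kI; rewrite [RHS]nt_natural !liftE nt_natural.
split=> [|u ut]; first by apply: nattransP => T x; apply: liftE.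
by apply: nattransP => T x; apply: (@kI T); rewrite /= liftE -ut.
Qed.

(** Kernels in [mod C], although characterised by maps from coherent functors
    only, are objectwise kernels because representable functors are coherent. *)
Lemma kernel_objectwise : is_kernel k a ->
  (forall T (z : sval K T), nt k z = 0 -> z = 0) /\
  (forall T, exact_at (@nt _ _ _ _ k T) (@nt _ _ _ _ a T)).
Proof.
move=> kP; have kM := kernel_mono kP; have [ak kU] := kP.
pose h T := yoneda C T.
split=> [T z kz|T].
  have [y yE] := yoneda_element z.
  have y0 : (y : hom (mod C) (h T) K) = 0.
    apply: (mono0 kM); apply: nattransP => S t.
    by rewrite /= yE nt_natural kz raddf0.
  by have := yE T (idm C T); rewrite mres1 y0.
apply/exact_atP; split=> [z|x ax]; first by rewrite -[LHS]/(nt (a ∘ k) z) ak.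
have [y yE] := yoneda_element x.
have [|u [uy _]] := kU (h T) y.
  by apply: nattransP => S t; rewrite /= yE nt_natural ax raddf0.
exists (nt u (idm C T : representable C T T)).
by rewrite -[LHS]/(nt (k ∘ u) _) uy yE mres1.
Qed.

End Kernels.

(** Lift [a : F -> G] to [y : Y1 -> Y2] between presentations. An element of
    the objectwise kernel of [a] is the class of a [t] such that [y ∘ t] factors
    through [f2], so the weak pullback [P] of [y] and [f2] covers this kernel.
    The relations are the elements of [P] whose image in [Y1] factors through
    [f1], and these are covered by a second weak pullback [Q]. *)
Lemma mod_has_kernels :
  is_additive C -> has_pseudo_kernels C -> has_kernels (mod C).
Proof.
move=> addC pkC F G a.
have [X1 [Y1 [f1 [p1 p1P]]]] := svalP F.
have [X2 [Y2 [f2 [p2 p2P]]]] := svalP G.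
have [y yE] := (p2P Y1).2 (nt a (nt p1 (idm C Y1 : representable C Y1 Y1))).
have ayE T (t : hom C T Y1) : nt a (nt p1 (t : representable C Y1 T)) =
    nt p2 (y ∘ t : representable C Y2 T).
  by rewrite presentationE nt_natural -yE -nt_natural.
have [P [r [s [rs rsU]]]] := weak_pullback_exists y f2 addC pkC.
have [Q [q [q' [rq qU]]]] := weak_pullback_exists r f1 addC pkC.
pose N := kernel_submodule a; pose k := sub_incl N.
have ap1r T (t : hom C T P) : smem N (nt p1 (r ∘ t : representable C Y1 T)).
  apply/eqP; rewrite ayE compmA rs -compmA; apply/(p2P T).1.
  by exists (s ∘ t).
have [p pE] : exists p : nattrans (representable C P) (sub_module N),
    forall T (t : hom C T P),
      nt k (nt p (t : representable C P T)) = nt p1 (r ∘ t : representable C Y1 T).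
  unshelve eexists (@NatTrans _ _ (representable C P) (sub_module N)
    (fun T t => SubAt (ap1r T t) : sub_module N T) _ _).
  - move=> T t t'; apply: sub_val_inj; rewrite sub_valB /= compBr.
    by rewrite raddfB.
  - by move=> S T f t; apply: sub_val_inj; rewrite /= -nt_natural /= compmA.
  - by [].
have kI T (z : sub_module N T) : nt k z = 0 -> z = 0.
  by move=> kz; apply: sub_val_inj; rewrite -[LHS]/(nt k z) kz -[RHS]/(nt k 0) raddf0.
have pP : is_presentation q p.
  move=> T; split.
    apply/exact_atP; split=> [t|t pt].
      apply: kI; rewrite pE /= compmA rq -compmA; apply/(p1P T).1.
      by exists (q' ∘ t).
    have /(p1P T).1[x /= xt] : nt p1 (r ∘ t : representable C Y1 T) = 0.
      by rewrite -pE pt raddf0.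
    by have [|w [<- _]] := qU T t x; [|exists w].
  move=> z; have [t tz] := (p1P T).2 (nt k z).
  have /eqP az := sub_valP z.
  have /(p2P T).1[x /= xt] : nt p2 (y ∘ t : representable C Y2 T) = 0.
    by rewrite -ayE tz.
  have [|w [rw _]] := rsU T t x; first by [].
  exists w; apply/eqP; rewrite -subr_eq0; apply/eqP/kI.
  by rewrite raddfB /= -[sub_val (nt p w)]/(nt k (nt p w)) pE rw tz subrr.
have cK : coherent (sub_module N) by exists Q, P, q, p.
pose K : {F : cmodule C | coherent F} := exist _ _ cK.
exists K, (k : hom (mod C) K F); apply: objectwise_kernel => [T|T].
  exact: kI.
apply/exact_atP; split=> [z|x /eqP ax]; first exact/eqP/(sub_valP z).
by exists (SubAt (N := N) ax).
Qed.

End Coherent.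

(** * Preservation of pseudo-kernels and of kernels by [v] *)

Section CokernelFunctor.
Variables (ob : Type) (C : preadditive ob) (cokC : has_cokernels C).
Notation v := (v cokC).
Notation eta := (v_unit cokC).

Lemma v_map_unit (F G : {F : cmodule C | coherent F}) (a : hom (mod C) F G) T
    (x : sval F T) :
  fmap v a ∘ nt (eta F) x = nt (eta G) (nt a x).
Proof. exact: (congr1 (fun b : nattrans _ _ => nt b x) (v_mapE cokC a)). Qed.

Lemma v_unit_res (F : {F : cmodule C | coherent F}) S T (f : hom C S T)
    (x : sval F T) :
  nt (eta F) (mres (sval F) f x) = nt (eta F) x ∘ f.
Proof. exact: nt_natural. Qed.

Lemma v_map0 (F G : {F : cmodule C | coherent F}) :
  fmap v (0 : hom (mod C) F G) = 0.
Proof.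
apply: v_eq; rewrite v_mapE compm0.
by apply: nattransP => T x /=; rewrite comp0m.
Qed.

Lemma preserves_pseudo_kernels_left_exact :
  preserves_pseudo_kernels v -> is_left_exact v.
Proof.
move=> vP F G H k a /kernelP[ka /mono_zero_pseudo_kernel k0].
apply/kernelP; split; first exact: vP ka.
by apply/mono_zero_pseudo_kernel; rewrite -(v_map0 F F); apply: vP.
Qed.

(** A pseudo-kernel [b] of [a] is [k ∘ e] with [k] the kernel of [a] and [e]
    split by [s]; [v] keeps [k] a kernel and [e] split. *)
Lemma left_exact_preserves_pseudo_kernels :
  has_kernels (mod C) -> is_left_exact v -> preserves_pseudo_kernels v.
Proof.
move=> kM vL B F G b a /pseudo_kernelP[ab bU].
have [K [k kP]] := kM _ _ a.
have [[ak kU] kmono] := (kP, kernel_mono kP).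
have [s bs] := bU _ _ ak; have [e [ke _]] := kU _ _ ab.
have es : e ∘ s = idm (mod C) K by apply: kmono; rewrite compmA ke bs compm1.
have [vak vkU] := vL _ _ _ _ _ kP.
apply/pseudo_kernelP; split=> [|T t at0]; first by rewrite -fmapM ab v_map0.
have [u [ut _]] := vkU _ _ at0; exists (fmap v s ∘ u).
by rewrite compmA -fmapM bs.
Qed.

Lemma left_exact_mono (F G : {F : cmodule C | coherent F})
    (a : hom (mod C) F G) :
  has_kernels (mod C) -> is_left_exact v -> is_mono a -> is_mono (fmap v a).
Proof.
move=> kM vL /mono_zero_pseudo_kernel/left_exact_preserves_pseudo_kernels va.
by apply/mono_zero_pseudo_kernel; rewrite -(v_map0 F F); apply: va.
Qed.

(** * The functor [v] on representable functors *)

Section VYoneda.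

(** The inverse of the counit [v (Hom(-, Y)) -> Y] of the adjunction; the
    unit at a representable functor is composition with it. *)
Definition counit_inv Y : hom C Y (v (yoneda C Y)) :=
  nt (eta (yoneda C Y)) (idm C Y : representable C Y Y).

Lemma counit_invE T Y (f : hom C T Y) :
  nt (eta (yoneda C Y)) (f : representable C Y T) = counit_inv Y ∘ f.
Proof. by rewrite -v_unit_res /= comp1m. Qed.

(** The functor [Hom(-, Y)] is presented by [0 : Y -> Y], so [counit_inv Y] is a
    cokernel of zero. *)
Lemma counit_inv_iso Y :
  exists s, s ∘ counit_inv Y = idm C Y /\ counit_inv Y ∘ s = idm C _.
Proof.
have pP : is_presentation (0 : hom C Y Y) (nt_id (representable C Y)).
  move=> X; split=> [|x]; last by exists x.
  apply/exact_atP; split=> [x|x /= ->]; first exact: comp0m.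
  by exists 0; rewrite /= comp0m.
have cP := v_presentation cokC (F := yoneda C Y) pP.
have [_ /(_ _ (idm C Y))[|s [sc _]]] := cP; first exact: compm0.
exists s; split=> //; apply: (cokernel_epi cP).
by rewrite -compmA [X in _ ∘ X]sc compm1 comp1m.
Qed.

Lemma counit_inv_mono Y : is_mono (counit_inv Y).
Proof.
have [s [sc _]] := counit_inv_iso Y.
by move=> T a b /(congr1 (comp C s)); rewrite !compmA sc !comp1m.
Qed.

Lemma v_yoneda X (F : {F : cmodule C | coherent F})
    (a : hom (mod C) (yoneda C X) F) :
  fmap v a ∘ counit_inv X = nt (eta F) (nt a (idm C X : representable C X X)).
Proof. exact: v_map_unit. Qed.

Lemma counit_inv_natural X Y (f : hom C X Y) :
  fmap v (fmap (yoneda C) f) ∘ counit_inv X = counit_inv Y ∘ f.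
Proof. by rewrite v_yoneda counit_invE /= compm1. Qed.

End VYoneda.

(** * If [v] is left exact then [C] is abelian *)

Section LeftExactToAbelian.
Hypotheses (addC : is_additive C) (pkC : has_pseudo_kernels C).
Hypothesis vL : is_left_exact v.

(** The kernel of [Hom(-, f)] in [mod C] need not be representable; its image
    under [v] is the kernel of [f]. *)
Lemma left_exact_kernels : has_kernels C.
Proof.
move=> Y Z f; have [K [k kP]] := mod_has_kernels addC pkC (fmap (yoneda C) f).
have [s [sc cs]] := counit_inv_iso Y.
exists (v K), (s ∘ fmap v k).
apply: (kernel_transport (i := idm C (v K)) (i' := idm C (v K))
  (j := counit_inv Y) (l := counit_inv Z) _ _ _ _ _ _ (vL kP)).
- exact: comp1m.
- by move=> T a b; rewrite !comp1m.
- exact: counit_inv_mono.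
- exact: counit_inv_mono.
- by rewrite compm1 compmA cs comp1m.
- exact: counit_inv_natural.
Qed.

(** The map [Hom(-, m)] is the kernel of the projection of [Hom(-, Y)] onto its
    cokernel, and [v] preserves this kernel. *)
Lemma left_exact_mono_is_kernel X Y (m : hom C X Y) :
  is_mono m -> exists Z (f : hom C Y Z), is_kernel m f.
Proof.
move=> mM; have [F [p pP]] := cokernel_coherent m.
have kP : is_kernel (fmap (yoneda C) m) (p : hom (mod C) (yoneda C Y) F).
  apply: objectwise_kernel => [T z /(mono0 mM)//|T]; first exact: (pP T).1.
have [s [_ cs]] := counit_inv_iso X.
exists (v F), (fmap v (p : hom (mod C) (yoneda C Y) F) ∘ counit_inv Y).
apply: (kernel_transport (i := counit_inv X) (i' := s)
  (j := counit_inv Y) (l := idm C _) _ _ _ _ _ _ (vL kP)).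
- exact: cs.
- exact: counit_inv_mono.
- exact: counit_inv_mono.
- by move=> T a b; rewrite !comp1m.
- exact: counit_inv_natural.
- by rewrite comp1m.
Qed.

(** The cokernel [F] of [Hom(-, ker e)] is the image of [Hom(-, e)]. Its
    embedding in [Hom(-, Z)] is sent by [v] to the comparison [Coker (ker e) -> Z],
    which is therefore a monomorphism, and an epimorphism like [e]. *)
Lemma left_exact_epi_is_cokernel Y Z (e : hom C Y Z) :
  is_epi e -> exists X (f : hom C X Y), is_cokernel f e.
Proof.
move=> eE; have [X [k kP]] := left_exact_kernels e; have [ek kU] := kP.
exists X, k; split=> // T t tk.
have [F [p pP]] := cokernel_coherent k.
have [_ cU] := v_presentation cokC pP; set c := nt _ _ in cU.
have [d dE] := presentation_desc pP ek.
pose d' : hom (mod C) F (yoneda C Z) := d.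
have dM : is_mono d'.
  apply: monoP => G a da; apply: nattransP => S x.
  have [y yx] := (pP S).2 (nt a x).
  have ey : e ∘ y = 0 by rewrite -dE yx -[LHS]/(nt (d' ∘ a) x) da.
  by rewrite -yx; have [u [<- _]] := kU _ _ ey; apply/(pP S).1; exists u.
have vdM := left_exact_mono (mod_has_kernels addC pkC) vL dM.
have dc : fmap v d' ∘ c = counit_inv Z ∘ e.
  by rewrite v_map_unit [nt d' _]dE compm1 counit_invE.
have [s [sc cs]] := counit_inv_iso Z.
have vdE : is_epi (fmap v d').
  apply: epiP => V g gd; have /(epi0 eE) : (g ∘ counit_inv Z) ∘ e = 0.
    by rewrite -compmA -dc compmA gd comp0m.
  by move=> gc; rewrite -[g]compm1 -cs compmA gc comp0m.
(* A monomorphism and epimorphism is the kernel of zero, hence invertible. *)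
have [V [g [gd gU]]] := left_exact_mono_is_kernel vdM.
have [|i [di _]] := gU _ (idm C _); first by rewrite (epi0 vdE gd) comp0m.
have idv : i ∘ fmap v d' = idm C _ by apply: vdM; rewrite compmA di compm1 comp1m.
have [u [uc _]] := cU _ _ tk.
exists (u ∘ i ∘ counit_inv Z); split=> [|w we].
  by rewrite -compmA -dc compmA -(compmA u) idv compm1.
apply: eE; rewrite we -compmA -dc compmA -(compmA u) idv compm1.
exact: uc.
Qed.

Lemma left_exact_abelian : is_abelian C.
Proof.
split=> //; first exact: left_exact_kernels.
  exact: left_exact_mono_is_kernel.
exact: left_exact_epi_is_cokernel.
Qed.

End LeftExactToAbelian.

(** * If [C] is abelian then [v] is left exact *)

Section AbelianToLeftExact.
Hypothesis abC : is_abelian C.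

(** The projection onto [v F] of the target of a presentation is an
    epimorphism; pull it back along [t]. *)
Lemma v_unit_locally_surj (F : {F : cmodule C | coherent F}) T
    (t : hom C T (v F)) :
  exists T' (e : hom C T' T) (x : sval F T'),
    is_epi e /\ nt (eta F) x = t ∘ e.
Proof.
have cE := cokernel_epi (cokerP cokC (pres_map (pres F))).
have [T' [y [e [eE ye]]]] := epi_pullback abC t cE.
exists T', e, (nt (pres_proj (pres F)) y); split=> //.
by rewrite v_unitE.
Qed.

(** Lift [x] to the target of a presentation of [F]: the lift dies in [v F], so
    up to an epimorphism it comes from the source of the presentation. *)
Lemma v_unit_locally_inj (F : {F : cmodule C | coherent F}) T (x : sval F T) :
  nt (eta F) x = 0 ->
  exists T' (e : hom C T' T), is_epi e /\ mres (sval F) e x = 0.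
Proof.
have [y <-] := (presP (pres F) T).2 x; rewrite v_unitE => cy.
have [T' [e [z [eE zy]]]] :=
  exact_epi_lift abC (cokerP cokC (pres_map (pres F))) cy.
exists T', e; split=> //; rewrite -nt_natural /= -zy.
by apply/(presP (pres F) T').1; exists z.
Qed.

(** Both the injectivity of [v k] and the factorisation through it are obtained
    by replacing a morphism to [v K] or [v F] by an element of [K] or [F] on an
    epimorphic cover, and using the objectwise exactness of [K -> F -> G]. *)
Lemma abelian_left_exact : is_left_exact v.
Proof.
move=> K F G k a kP; have [k0 ka] := kernel_objectwise kP.
have [ak _] := kP.
have vkM : is_mono (fmap v k).
  apply: monoP => T t kt.
  have [T1 [e1 [z [e1E zt]]]] := v_unit_locally_surj t.
  have [|T2 [e2 [e2E kz]]] := @v_unit_locally_inj _ _ (nt k z).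
    by rewrite -v_map_unit zt compmA kt comp0m.
  have z0 : mres (sval K) e2 z = 0 by apply: k0; rewrite nt_natural.
  apply: (epi0 (epi_comp e1E e2E)); rewrite compmA -zt.
  by rewrite -v_unit_res z0 raddf0.
apply/kernelP; split=> //; apply/pseudo_kernelP.
split=> [|T t at0]; first by rewrite -fmapM ak v_map0.
have [T1 [e1 [x [e1E xt]]]] := v_unit_locally_surj t.
have [|T2 [e2 [e2E ax]]] := @v_unit_locally_inj _ _ (nt a x).
  by rewrite -v_map_unit xt compmA at0 comp0m.
have /(ka T2)[z kz] : nt a (mres (sval F) e2 x) = 0 by rewrite nt_natural.
apply: (epi_locally_factor abC vkM (epi_comp e1E e2E) (z := nt (eta K) z)).
by rewrite v_map_unit kz v_unit_res compmA -xt.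
Qed.

End AbelianToLeftExact.
End CokernelFunctor.

Theorem theorem2p6 (ob : Type) (C : preadditive ob)
  (addC : is_additive C) (cokC : has_cokernels C)
  (pkC : has_pseudo_kernels C) :
  (preserves_pseudo_kernels (v cokC) <-> is_left_exact (v cokC)) /\
  (is_left_exact (v cokC) <-> is_abelian C).
Proof.
split; split.
- exact: preserves_pseudo_kernels_left_exact.
- exact: left_exact_preserves_pseudo_kernels (mod_has_kernels addC pkC).
- exact: left_exact_abelian.
- exact: abelian_left_exact.
Qed.
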